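(* For all $d\in\mathbb{N}$, there is a graph $G$ of maximum degree $5$ with degenerate distance-number $\mathrm{dn}'(G)>d$.
   Context: A degenerate drawing of a graph maps vertices to distinct points in the plane and each edge to the open straight-line segment joining its endpoints. The degenerate distance-number $\mathrm{dn}'(G)$ of a graph $G$ is the minimum number of distinct edge-lengths over all degenerate drawings of $G$. *)

(* Defs.v *)
From mathcomp Require Import all_boot all_order all_algebra.
From mathcomp Require Import boolp reals.

Set Implicit Arguments.
Unset Strict Implicit.
Unset Printing Implicit Defensive.

Import Order.TTheory GRing.Theory Num.Theory.
Local Open Scope ring_scope.

Record sgraph := SGraph {
  vertex :> finType;
  adj : rel vertex;
  adj_sym : symmetric adj;
  adj_irr : irreflexive adj }.

Definition degree (G : sgraph) (v : G) : nat := #|[set w | adj v w]|.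

Definition max_degree (G : sgraph) : nat := \max_(v : G) degree v.

(* The Euclidean distance in the plane, written out because the norm that the
   library puts on a product (or on row vectors) is the sup norm. *)
Definition edist (R : realType) (p q : R * R) : R :=
  Num.sqrt ((p.1 - q.1) ^+ 2 + (p.2 - q.2) ^+ 2).

(* A degenerate drawing is determined by the positions of the vertices: the
   edge vw is drawn as the open segment between the points of v and w.  Edges
   may overlap each other and pass through vertices. *)
Record degenerate_drawing (R : realType) (G : sgraph) := DegenerateDrawing {
  position :> G -> R * R;
  position_inj : injective position }.

(* Each edge is listed in both orientations, with the same length. *)
Definition edge_lengths (R : realType) (G : sgraph)
    (D : degenerate_drawing R G) : seq R :=
  [seq edist (D e.1) (D e.2) | e in [pred e : G * G | adj e.1 e.2]].

Definition num_edge_lengths (R : realType) (G : sgraph)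
    (D : degenerate_drawing R G) : nat :=
  size (undup (edge_lengths D)).

Definition line_position (R : realType) (G : sgraph) (v : G) : R * R :=
  ((enum_rank v)%:R, 0).

Lemma line_position_inj (R : realType) (G : sgraph) :
  injective (@line_position R G).
Proof.
move=> v w [] /eqP; rewrite eqr_nat => /eqP /val_inj.
exact: enum_rank_inj.
Qed.

Lemma num_edge_lengths_exists (R : realType) (G : sgraph) :
  exists n, `[< exists D : degenerate_drawing R G, num_edge_lengths D = n >].
Proof.
pose D := DegenerateDrawing (@line_position_inj R G).
by exists (num_edge_lengths D); apply/asboolP; exists D.
Qed.

Definition degenerate_distance_number (R : realType) (G : sgraph) : nat :=
  ex_minn (num_edge_lengths_exists R G).

(* Main.v *)
Require Import Defs.
From mathcomp Require Import all_boot all_order all_algebra all_fingroup.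
From mathcomp Require Import boolp reals.
From mathcomp Require Import zify ring lra.

(* The graphs considered are unions of five permutations of a set A of m
   elements, seen as 5-regular bipartite graphs on A + A.  A drawing with at
   most d distances is a point with 4m + d coordinates, and joining all pairs
   of A * A at one of these distances gives a bipartite graph H that contains
   the drawn one, that is determined by a zero pattern of quadratic polynomials,
   and that has O(m^(3/2)) edges because two circles meet at most twice.

   There are about m^(5m) graphs and only m^(4m + d) graphs H, but each H has
   too many subgraphs for a direct count.  So restrict to the subgraphs of a
   random sparse graph k, in which each vertex has 5 D possible neighbours, D
   being a large constant.  With probability close to 1, all the H meet k in
   O(m) edges, which contain only exp(O(m)) of the graphs; and the number of
   traces of the H on k is at most (O(1) D)^(4m + d), while k contains about
   D^(5m) of the graphs. *)

Set Implicit Arguments.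
Unset Strict Implicit.
Unset Printing Implicit Defensive.

Import Order.TTheory GRing.Theory Num.Theory.
Local Open Scope ring_scope.

(** * Zero patterns of quadratic polynomials *)

(** [None] stands for the constant 1, so pairs of options index all monomials of degree at most
    2. *)
Definition quadratic (K : fieldType) (V : finType) (F : (V -> K) -> K) : Prop :=
  exists c : option V * option V -> K, forall x,
    F x = \sum_w c w * (oapp x 1 w.1 * oapp x 1 w.2).

Lemma quadratic_mul (K : fieldType) (V : finType) (w : option V * option V) :
  quadratic (fun x : V -> K => oapp x 1 w.1 * oapp x 1 w.2).
Proof.
exists (fun w' => (w' == w)%:R) => x.
rewrite (bigD1 w) //= eqxx mul1r big1 ?addr0 // => w' /negPf ->.
by rewrite mul0r.
Qed.

Lemma quadraticD (K : fieldType) (V : finType) (F G : (V -> K) -> K) :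
  quadratic F -> quadratic G -> quadratic (fun x => F x + G x).
Proof.
move=> [c Fc] [c' Gc]; exists (fun w => c w + c' w) => x.
by rewrite Fc Gc -big_split; apply: eq_bigr => w _; rewrite mulrDl.
Qed.

Lemma quadraticZ (K : fieldType) (V : finType) (a : K) (F : (V -> K) -> K) :
  quadratic F -> quadratic (fun x => a * F x).
Proof.
move=> [c Fc]; exists (fun w => a * c w) => x.
by rewrite Fc mulr_sumr; apply: eq_bigr => w _; rewrite mulrA.
Qed.

(** Here [h] picks one term from each of the quadratics indexed by [E]; this is the degree in [v] of
    the product of the chosen monomials. *)
Definition exponent (V E : finType) (h : {ffun E -> option V * option V})
    (v : V) : nat :=
  (\sum_e (((h e).1 == Some v) + ((h e).2 == Some v)))%N.

Lemma exponent_sum (V E : finType) (h : {ffun E -> option V * option V}) :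
  (\sum_v exponent h v <= 2 * #|E|)%N.
Proof.
rewrite exchange_big /=.
have -> : (2 * #|E| = \sum_(e : E) 2)%N by rewrite sum_nat_const mulnC.
apply: leq_sum => e _; rewrite big_split /=.
have le1 (o : option V) : (\sum_v (o == Some v) <= 1)%N.
  case: o => [v|]; last by rewrite big1.
  rewrite (bigD1 v) //= eqxx big1 // => w /negPf vw.
  by apply/eqP; rewrite eqb0; apply/eqP; case=> /eqP; rewrite eq_sym vw.
by rewrite -[2%N]/(1 + 1)%N leq_add.
Qed.

Lemma prod_exponent (K : fieldType) (V E : finType)
    (h : {ffun E -> option V * option V}) (x : V -> K) :
  \prod_e (oapp x 1 (h e).1 * oapp x 1 (h e).2) = \prod_v x v ^+ exponent h v.
Proof.
have E1 (o : option V) : oapp x 1 o = \prod_v x v ^+ (o == Some v).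
  case: o => [v|] /=; last by rewrite big1.
  rewrite (bigD1 v) //= eqxx expr1 big1 ?mulr1 // => w /negPf vw.
  by have -> : (Some v == Some w) = false by apply/eqP; case=> /eqP; rewrite eq_sym vw.
under eq_bigr do rewrite !E1 -big_split /=.
rewrite exchange_big; apply: eq_bigr => v _ /=.
rewrite /exponent; elim/big_rec2: _ => // e y n _ ->.
by rewrite !exprD.
Qed.

(* Rónyai, Babai and Ganapathy: pick a point realizing each zero pattern, and
   multiply the polynomials that do not vanish there.  These products are
   linearly independent, because the matrix of their values at the points is
   triangular for the order given by inclusion of zero patterns. *)
Lemma zero_pattern_bound (K : fieldType) (V E I : finType)
    (f : E -> (V -> K) -> K) (u : I -> V -> K) :
  (forall e, quadratic (f e)) ->
  injective (fun i => [set e | f e (u i) == 0]) ->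
  (#|I| <= 'C(#|V| + 2 * #|E|, #|V|))%N.
Proof.
move=> fq Zinj; set Z := fun i => _ in Zinj.
have /cid [c fc] : exists c : E -> option V * option V -> K, forall e x,
    f e x = \sum_w c e w * (oapp x 1 w.1 * oapp x 1 w.2).
  exists (fun e => sval (cid (fq e))) => e; exact: svalP (cid (fq e)).
(* A factor left out of the product becomes the constant 1, so that every [g i] expands over the
   same functions [h]. *)
pose c1 i e := if e \in Z i then (fun w => (w == (None, None))%:R) else c e.
pose g i x := \prod_(e | e \notin Z i) f e x.
have gE i x : g i x = \prod_e \sum_w c1 i e w * (oapp x 1 w.1 * oapp x 1 w.2).
  rewrite /g big_mkcond /=; apply: eq_bigr => e _.
  rewrite /c1; case: (e \in Z i) => /=; last exact: fc.
  rewrite (bigD1 (None, None)) //= !mulr1 big1 ?addr0 // => w /negPf ->.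
  by rewrite mul0r.
set n := (2 * #|E|)%N.
pose A := [set t : #|V|.-tuple 'I_n.+1 | (\sum_(i <- t) i <= n)%N].
pose ex (h : {ffun E -> option V * option V}) : #|V|.-tuple 'I_n.+1 :=
  [tuple inord (exponent h (enum_val k)) | k < #|V|].
have ex_le (h : {ffun E -> _}) v : (exponent h v <= n)%N.
  apply: (@leq_trans (\sum_v exponent h v)%N _ _ _ (exponent_sum h)).
  by rewrite (bigD1 v) //= leq_addr.
have exA h : ex h \in A.
  rewrite inE big_tuple.
  under eq_bigr do rewrite tnth_mktuple inordK ?ltnS ?ex_le //.
  by rewrite -(big_enum_val (exponent h)); exact: exponent_sum.
pose mono (t : #|V|.-tuple 'I_n.+1) (x : V -> K) :=
  \prod_(k < #|V|) x (enum_val k) ^+ tnth t k.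
have monoE h x : mono (ex h) x = \prod_v x v ^+ exponent h v.
  rewrite [RHS](big_enum_val (fun v => x v ^+ exponent h v)).
  by apply: eq_bigr => k _; rewrite tnth_mktuple inordK ?ltnS ?ex_le.
pose b i t := \sum_(h | ex h == t) \prod_e c1 i e (h e).
have gsum i x : g i x = \sum_(t in A) b i t * mono t x.
  rewrite gE bigA_distr_bigA /=.
  rewrite (partition_big ex (mem A)) => [|h _]; last exact: exA.
  apply: eq_bigr => t _; rewrite mulr_suml; apply: eq_bigr => h /eqP <-.
  by rewrite big_split /= prod_exponent monoE.
rewrite -card_partial_ord_partitions -/n -/A.
(* The matrix of values factors through the monomials of degree at most [n], so its rank is at most
   [#|A|]. *)
pose P := \matrix_(i < #|I|, k < #|A|) b (enum_val i) (enum_val k).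
pose Q := \matrix_(k < #|A|, j < #|I|) mono (enum_val k) (u (enum_val j)).
have PQ i j : (P *m Q) i j = g (enum_val i) (u (enum_val j)).
  rewrite mxE gsum (big_enum_val (fun t => b _ t * mono t _)).
  by apply: eq_bigr => k _; rewrite !mxE.
suff free : row_free (P *m Q).
  by rewrite -(eqP free); exact: mulmx_max_rank.
have g_neq0 i j : (g i (u j) != 0) = (Z j \subset Z i).
  apply/prodf_neq0/subsetP => [gi e ej | sub e eNi].
    by apply: contraLR ej => /gi; rewrite inE.
  by have := contra (sub e) eNi; rewrite inE.
apply/inj_row_free => w wM; apply/rowP => i; rewrite mxE.
apply/eqP; apply/contraT => wi.
(* In column [j], with [Z j] largest among the nonzero coefficients, every other term vanishes: its
   pattern would contain [Z j], hence equal it. *)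
case: (arg_maxnP (fun j : 'I_#|I| => #|Z (enum_val j)|) (P := fun j => w 0 j != 0) wi).
move=> j wj jmax; have /rowP /(_ j) := wM.
rewrite !mxE (bigD1 j) //= PQ big1 ?addr0 => [|k kj].
  by move/eqP; rewrite mulf_eq0 (negPf wj) /= (negPf (_ : _ != 0)) ?g_neq0.
have [->|wk] := eqVneq (w 0 k) 0; first by rewrite mul0r.
rewrite PQ; have [->|] := eqVneq (g (enum_val k) (u (enum_val j))) 0.
  by rewrite mulr0.
rewrite g_neq0 => sub; have := jmax k wk => le.
have /eqP eqZ : Z (enum_val j) == Z (enum_val k) by rewrite eqEcard sub.
by case/negP: kj; rewrite -(inj_eq enum_val_inj) (Zinj _ _ eqZ).
Qed.

Lemma card_zero_patterns (K : fieldType) (V E I : finType)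
    (f : E -> (V -> K) -> K) (u : I -> V -> K) :
  (forall e, quadratic (f e)) ->
  (#|[set [set e | f e (u i) == 0%R] | i in setT]| <= 'C(#|V| + 2 * #|E|, #|V|))%N.
Proof.
move=> fq; set S := imset _ _.
have SP (Y : {Y | Y \in S}) : exists i, val Y == [set e | f e (u i) == 0].
  by case/imsetP: (valP Y) => i _ ->; exists i.
have <- : #|{: {Y | Y \in S}}| = #|S| by rewrite card_sig.
apply: (zero_pattern_bound (u := fun Y => u (xchoose (SP Y))) fq) => Y Y'.
by rewrite -(eqP (xchooseP (SP Y))) -(eqP (xchooseP (SP Y'))) => /val_inj.
Qed.

Lemma quadratic_sqrB (K : fieldType) (V : finType) (v w : V) :
  quadratic (fun x : V -> K => (x v - x w) ^+ 2).
Proof.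
have [c E] := quadraticD (quadraticD (quadratic_mul K (Some v, Some v))
  (quadraticZ (- 2) (quadratic_mul K (Some v, Some w))))
  (quadratic_mul K (Some w, Some w)).
by exists c => x; rewrite -E /=; ring.
Qed.

Lemma quadratic_var (K : fieldType) (V : finType) (v : V) :
  quadratic (fun x : V -> K => x v).
Proof.
have [c E] := quadratic_mul K (Some v, None).
by exists c => x; rewrite -E /= mulr1.
Qed.

(** * Pairs of points at few distances *)

Lemma card_set_pair (I J : finType) (P : {set I * J}) :
  #|P| = (\sum_i #|[set j | (i, j) \in P]|)%N.
Proof.
transitivity (\sum_i \sum_j ((i, j) \in P))%N.
  rewrite pair_bigA (eq_bigr (fun w => nat_of_bool (w \in P))) => [|[]//].
  by rewrite -sum1_card [LHS]big_mkcond; apply: eq_bigr => w _; case: (w \in P).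
apply: eq_bigr => i _; rewrite -sum1_card [RHS]big_mkcond.
by apply: eq_bigr => j _; rewrite inE; case: (_ \in P).
Qed.

Lemma card_union_bound (I T : finType) (F : I -> {set T}) (X : {set I}) (n : nat) :
  (forall i, i \in X -> #|F i| <= n)%N -> (#|\bigcup_(i in X) F i| <= #|X| * n)%N.
Proof.
move=> Fn; apply: (@leq_trans (\sum_(i in X) #|F i|)%N); last first.
  by rewrite -sum_nat_const; apply: leq_sum.
elim/big_rec2: _ => [|i p Y _ le1]; first by rewrite cards0.
by apply: leq_trans (leq_card_setU (F i) Y) _; rewrite leq_add2l.
Qed.

(** Squared, so that matching an entry of [z] is the vanishing of a quadratic polynomial in the
    coordinates and that entry. *)
Definition sqdist (K : realFieldType) (p q : K * K) : K :=
  (p.1 - q.1) ^+ 2 + (p.2 - q.2) ^+ 2.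

(** The differences of the three points are orthogonal to the line of centres, so [p1] and [p3] are
    each [p2] or its mirror image in that line. *)
Lemma circles_meet_twice (K : realFieldType) (q q' p1 p2 p3 : K * K) :
  q != q' ->
  sqdist p1 q = sqdist p2 q -> sqdist p2 q = sqdist p3 q ->
  sqdist p1 q' = sqdist p2 q' -> sqdist p2 q' = sqdist p3 q' ->
  [\/ p1 = p2, p2 = p3 | p3 = p1].
Proof.
case: q q' p1 p2 p3 => [x y] [x' y'] [x1 y1] [x2 y2] [x3 y3].
rewrite /sqdist /= xpair_eqE => qq e12 e23 e12' e23'.
pose wx := x - x'; pose wy := y - y'; pose N := wx ^+ 2 + wy ^+ 2.
have N0 : N != 0.
  rewrite /N paddr_eq0 ?sqr_ge0 // !sqrf_eq0 !subr_eq0; exact: qq.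
have o12 : (x1 - x2) * wx + (y1 - y2) * wy = 0 by rewrite /wx /wy; lra.
have o32 : (x3 - x2) * wx + (y3 - y2) * wy = 0 by rewrite /wx /wy; lra.
(* Up to a common scale, [l] and [k] locate [p1] and [p3] from [p2] along the perpendicular, and [t]
   locates [p2] from [q]; the root [- 2 * t] is the mirror image. *)
pose l := (y1 - y2) * wx - (x1 - x2) * wy.
pose k := (y3 - y2) * wx - (x3 - x2) * wy.
pose t := (y2 - y) * wx - (x2 - x) * wy.
have l0 : l * (l + 2 * t) = 0.
  have -> : l * (l + 2 * t) =
      N * ((x1 - x) ^+ 2 + (y1 - y) ^+ 2 - ((x2 - x) ^+ 2 + (y2 - y) ^+ 2)) -
      ((x1 - x2) * wx + (y1 - y2) * wy) *
      ((x1 + x2 - 2 * x) * wx + (y1 + y2 - 2 * y) * wy).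
    by rewrite /l /t /N; ring.
  by rewrite o12 e12 subrr mulr0 mul0r subrr.
have k0 : k * (k + 2 * t) = 0.
  have -> : k * (k + 2 * t) =
      N * ((x3 - x) ^+ 2 + (y3 - y) ^+ 2 - ((x2 - x) ^+ 2 + (y2 - y) ^+ 2)) -
      ((x3 - x2) * wx + (y3 - y2) * wy) *
      ((x3 + x2 - 2 * x) * wx + (y3 + y2 - 2 * y) * wy).
    by rewrite /k /t /N; ring.
  by rewrite o32 -e23 subrr mulr0 mul0r subrr.
have eqp a b c e : (a - c) * wx + (b - e) * wy = 0 ->
    (b - e) * wx - (a - c) * wy = 0 -> (a, b) = (c, e).
  move=> o1 o2.
  have xE : (a - c) * N = 0.
    have -> : (a - c) * N = wx * ((a - c) * wx + (b - e) * wy) -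
        wy * ((b - e) * wx - (a - c) * wy) by rewrite /N; ring.
    by rewrite o1 o2 !mulr0 subrr.
  have yE : (b - e) * N = 0.
    have -> : (b - e) * N = wy * ((a - c) * wx + (b - e) * wy) +
        wx * ((b - e) * wx - (a - c) * wy) by rewrite /N; ring.
    by rewrite o1 o2 !mulr0 addr0.
  move/eqP: xE; rewrite mulf_eq0 (negPf N0) orbF subr_eq0 => /eqP ->.
  by move/eqP: yE; rewrite mulf_eq0 (negPf N0) orbF subr_eq0 => /eqP ->.
move/eqP: l0; rewrite mulf_eq0 => /orP[/eqP l0|/eqP lt].
  by apply: Or31; apply: eqp.
move/eqP: k0; rewrite mulf_eq0 => /orP[/eqP k0|/eqP kt].
  by apply: Or32; apply/esym/eqp.
apply: Or33; apply: eqp; first by lra.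
by rewrite /l /k /t in lt kt *; lra.
Qed.

(** Each of the [#|C| ^ 2] pairs of distances gives two circles with distinct centres, which share
    at most two points. *)
Lemma common_neighbours_bound (K : realFieldType) (A C : finType)
    (p : A -> K * K) (z : C -> K) (q q' : K * K) :
  injective p -> q != q' ->
  (#|[set a | [exists c, sqdist (p a) q == z c]
            & [exists c, sqdist (p a) q' == z c]]| <= 2 * #|C| ^ 2)%N.
Proof.
move=> pinj qq.
pose S (w : C * C) := [set a | (sqdist (p a) q == z w.1) && (sqdist (p a) q' == z w.2)].
have S2 w : (#|S w| <= 2)%N.
  rewrite leqNgt; apply/negP => /card_gt2P[a1 [a2 [a3 [[]]]]].
  rewrite !inE => /andP[/eqP h1 /eqP h1'] /andP[/eqP h2 /eqP h2'] /andP[/eqP h3 /eqP h3'].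
  have := @circles_meet_twice _ q q' (p a1) (p a2) (p a3) qq.
  rewrite h1 h1' h2 h2' h3 h3' => /(_ erefl erefl erefl erefl).
  by case=> /pinj ->; rewrite eqxx => -[].
apply: (@leq_trans #|\bigcup_(w in [set: C * C]) S w|).
  apply/subset_leq_card/subsetP => a.
  rewrite inE => /andP[/existsP[c ac] /existsP[c' ac']].
  by apply/bigcupP; exists (c, c'); rewrite // inE ac.
apply: leq_trans (card_union_bound (fun w _ => S2 w)) _.
by rewrite cardsT card_prod mulnC mulnn.
Qed.

(* Kővári, Sós and Turán *)
Lemma bounded_codegree_bound (A B : finType) (H : {set A * B}) (t : nat) :
  (forall b b', b != b' ->
     #|[set a | (a, b) \in H & (a, b') \in H]| <= t)%N ->
  (#|H| ^ 2 <= #|A| * (#|A| * #|B| + t * #|B| ^ 2))%N.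
Proof.
move=> Ht; pose deg a := (\sum_b ((a, b) \in H))%N.
have HE : #|H| = (\sum_a deg a)%N.
  rewrite card_set_pair; apply: eq_bigr => a _; rewrite -sum1_card big_mkcond.
  by apply: eq_bigr => b _; rewrite inE; case: (_ \in H).
have cauchy : (#|H| ^ 2 <= #|A| * \sum_a deg a ^ 2)%N.
  rewrite -(leq_pmul2l (isT : 0 < 2)%N) HE -mulnn big_distrlr /=.
  rewrite big_distrr /=.
  apply: (@leq_trans (\sum_a \sum_a' (deg a ^ 2 + deg a' ^ 2))%N).
    apply: leq_sum => a _; rewrite big_distrr; apply: leq_sum => a' _.
    exact: (nat_Cauchy _ _).1.
  under eq_bigr do rewrite big_split /= sum_nat_const.
  by rewrite big_split /= sum_nat_const -big_distrr /= addnn mul2n.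
apply: leq_trans cauchy _; rewrite leq_mul2l; apply/orP; right.
(* Pairs of edges with a common end in [A] are sorted by their ends in [B]; a diagonal pair [b = b']
   costs at most [#|A|]. *)
have -> : (\sum_a deg a ^ 2 = \sum_b \sum_b' #|[set a | (a, b) \in H & (a, b') \in H]|)%N.
  under [LHS]eq_bigr do rewrite -mulnn big_distrlr /=.
  rewrite exchange_big /=; apply: eq_bigr => b _.
  rewrite exchange_big /=; apply: eq_bigr => b' _.
  rewrite -sum1_card [RHS]big_mkcond; apply: eq_bigr => a _ /=.
  by rewrite inE; do 2!case: (_ \in H).
apply: (@leq_trans (\sum_(b : B) (#|A| + t * #|B|))%N); last first.
  by rewrite sum_nat_const mulnDr mulnCA mulnn mulnC.
apply: leq_sum => b _; rewrite (bigD1 b) //= leq_add ?max_card //.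
apply: (@leq_trans (\sum_(b' | b' != b) t)%N).
  by apply: leq_sum => b'; rewrite eq_sym => /Ht.
by rewrite sum_nat_const mulnC leq_mul2l max_card orbT.
Qed.

Lemma few_distances_bound (K : realFieldType) (A B C : finType)
    (p : A -> K * K) (q : B -> K * K) (z : C -> K) (s : nat) :
  injective p -> injective q -> #|A| = (s ^ 2)%N -> #|B| = (s ^ 2)%N ->
  (#|[set w : A * B | [exists c, sqdist (p w.1) (q w.2) == z c]]|
     <= (2 * #|C| + 1) * s ^ 3)%N.
Proof.
move=> pinj qinj cA cB; set H := [set w | _].
have codeg b b' : b != b' ->
    (#|[set a | (a, b) \in H & (a, b') \in H]| <= 2 * #|C| ^ 2)%N.
  rewrite -(inj_eq qinj) => bb; apply: leq_trans (common_neighbours_bound z pinj bb).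
  by apply/subset_leq_card/subsetP => a; rewrite !inE.
have := bounded_codegree_bound codeg; rewrite cA cB => le.
rewrite -(@leq_exp2r _ _ 2) //; apply: leq_trans le _.
rewrite [leqLHS](_ : _ = (1 + 2 * #|C| ^ 2) * (s ^ 3) ^ 2)%N; last by ring.
by rewrite expnMn leq_mul2r sqrnD; apply/orP; right; nia.
Qed.

Definition at_distance (K : realFieldType) (A B C : finType)
    (p : A -> K * K) (q : B -> K * K) (z : C -> K) : {set A * B} :=
  [set w | [exists c, sqdist (p w.1) (q w.2) == z c]].

(** The variables are two coordinates per point and the entries of [z]. Through [phi] the same bound
    serves for all pairs and for those proposed by a fixed [k]. *)
Lemma card_distance_patterns (K : realFieldType) (A B C E I : finType)
    (phi : E -> A * B)
    (p : I -> A -> K * K) (q : I -> B -> K * K) (z : I -> C -> K) :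
  (#|[set [set e | phi e \in at_distance (p i) (q i) (z i)] | i in setT]|
    <= 'C(2 * (#|A| + #|B|) + #|C| + 2 * (#|E| * #|C|), 2 * (#|A| + #|B|) + #|C|))%N.
Proof.
pose V : finType := ((A + B) * bool + C)%type.
have cV : (2 * (#|A| + #|B|) + #|C| = #|V|)%N.
  by rewrite card_sum card_prod card_sum card_bool mulnC.
pose u i (v : V) := match v with
  | inl (inl a, b) => if b then (p i a).1 else (p i a).2
  | inl (inr a, b) => if b then (q i a).1 else (q i a).2
  | inr c => z i c
  end.
pose f (e : E * C) (x : V -> K) :=
  (x (inl (inl (phi e.1).1, true)) - x (inl (inr (phi e.1).2, true))) ^+ 2 +
  (x (inl (inl (phi e.1).1, false)) - x (inl (inr (phi e.1).2, false))) ^+ 2 +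
  -1 * x (inr e.2).
have fq e : quadratic (f e).
  apply: quadraticD (quadraticZ _ (quadratic_var _ _)).
  by apply: quadraticD; apply: quadratic_sqrB.
rewrite cV -card_prod; apply: leq_trans (card_zero_patterns u fq).
(* A zero pattern also records which entry of [z] is matched; [g] forgets it. *)
pose g (Y : {set E * C}) := [set e | [exists c, (e, c) \in Y]].
have -> : [set [set e | phi e \in at_distance (p i) (q i) (z i)] | i in setT] =
    g @: [set [set e | f e (u i) == 0] | i in setT].
  rewrite -imset_comp; apply: eq_imset => i /=; apply/setP => e; rewrite !inE.
  apply: eq_existsb => c; rewrite !inE /f /u /= mulN1r subr_eq0 //.
exact: leq_imset_card.
Qed.

Lemma prod_mean_bound (A : finType) (y : A -> nat) :
  (#|A| ^ #|A| * \prod_a y a <= (\sum_a y a) ^ #|A|)%N.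
Proof.
have [] := @leif_AGM_scaled int A predT (fun a => (y a)%:R).
  by move=> a _; rewrite mulrn_wge0 ?ler0n.
under eq_bigr do rewrite -mulrnA.
rewrite -natr_sum -natr_prod -natrX ler_nat big_split /= => le _.
by rewrite mulnC -prod_nat_const.
Qed.

Local Close Scope ring_scope.

(** * Counting graphs inside a random sparse graph *)

(* [k (a, i, j)] is the [j]-th candidate for the image of [a] under the [i]-th
   permutation.  The bound on [hits] below is Markov's inequality for the
   exponential moment [s ^ #|hits k H|]. *)
Definition hits (A : finType) (l D : nat) (k : {ffun A * 'I_l * 'I_D -> A})
    (H : {set A * A}) : {set A * 'I_l * 'I_D} :=
  [set w | (w.1.1, k w) \in H].

(** The values of [k] are independent, so the sum is a product of factors [y a]; the inequality of
    means bounds it through the sum of the [y a], which depends only on the number of edges of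
    [H]. *)
Lemma sum_exp_hits (A : finType) (l D s c : nat) (H : {set A * A}) :
  (s * #|H| <= c * #|A| ^ 2)%N ->
  (\sum_(k : {ffun A * 'I_l * 'I_D -> A}) s ^ #|hits k H|
     <= (c.+1 * #|A|) ^ (#|A| * l * D))%N.
Proof.
move=> Hc; set m := #|A|.
pose y a := (\sum_b (if (a, b) \in H then s else 1))%N.
have E1 : (\sum_(k : {ffun A * 'I_l * 'I_D -> A}) s ^ #|hits k H| =
    (\prod_a y a) ^ (l * D))%N.
  transitivity (\prod_(w : A * 'I_l * 'I_D) y w.1.1)%N.
    rewrite bigA_distr_bigA /=; apply: eq_bigr => k _.
    rewrite -big_mkcond /= prod_nat_const; congr (_ ^ _)%N.
    by apply: eq_card => w; rewrite inE.
  rewrite -(pair_bigA _ (fun w (k : 'I_D) => y w.1)) /=.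
  rewrite -(pair_bigA _ (fun a (i : 'I_l) => \prod_(k < D) y a)%N) /=.
  under eq_bigr do rewrite !prod_nat_const !card_ord -expnM mulnC.
  by rewrite (big_morph _ (fun x y => expnMn x y _) (exp1n _)).
have yle : (\sum_a y a <= c.+1 * m ^ 2)%N.
  apply: (@leq_trans (\sum_(w : A * A) (1 + s * (w \in H)))%N).
    rewrite pair_bigA; apply: leq_sum => -[a b] _ /=.
    by case: (_ \in H); rewrite ?muln1 ?muln0 ?leq_addl.
  rewrite big_split /= sum_nat_const card_prod muln1 mulnn -big_distrr /=.
  rewrite mulSn leq_add2l; apply: leq_trans Hc; rewrite leq_mul2l; apply/orP; right.
  by rewrite -sum1_card [leqRHS]big_mkcond leq_sum // => w _; case: (w \in H).
rewrite E1 -mulnA [leqRHS]expnM.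
have [->|ld] := posnP (l * D)%N; first by rewrite !expn0.
rewrite leq_exp2r //; have [m0|m0] := posnP m.
  rewrite m0 expn0 big1 // => a _; exfalso.
  by move: m0; rewrite /m => /card0_eq/(_ a).
have m0' : (0 < m ^ m)%N by rewrite expn_gt0 m0.
rewrite -(leq_pmul2l m0'); apply: leq_trans (prod_mean_bound y) _.
by rewrite -expnMn leq_exp2r // mulnCA mulnn.
Qed.

Lemma heavy_bound (A : finType) (l D s c L : nat) (H : {set A * A}) :
  (0 < s)%N -> (s * #|H| <= c * #|A| ^ 2)%N ->
  (#|[set k : {ffun A * 'I_l * 'I_D -> A} | L <= #|hits k H|]| * s ^ L
     <= (c.+1 * #|A|) ^ (#|A| * l * D))%N.
Proof.
move=> s0 /(@sum_exp_hits _ l D); apply: leq_trans.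
rewrite -sum_nat_const big_mkcond; apply: leq_sum => k _.
by rewrite inE; case: (leqP L) => // le; rewrite leq_pexp2l.
Qed.

(** A section with [n] elements offers [n <= 2 ^ n] choices. *)
Lemma card_sections (W K : finType) (P : {set W * K}) :
  (#|[set c : {ffun W -> K} | [forall w, (w, c w) \in P]]| <= 2 ^ #|P|)%N.
Proof.
rewrite card_set_pair expn_sum.
apply: (@leq_trans #|family (fun w : W => mem [set k | (w, k) \in P])|).
  apply/subset_leq_card/subsetP => c; rewrite inE => /forallP cP.
  by apply/familyP => w; rewrite inE.
rewrite card_family foldrE big_map big_enum /=.
by apply: leq_prod => w _; rewrite ltnW // ltn_expl.
Qed.

Definition selects (A : finType) (l D : nat) (p : {ffun 'I_l -> {perm A}})
    (k : {ffun A * 'I_l * 'I_D -> A}) (c : {ffun A * 'I_l -> 'I_D}) : bool :=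
  [forall w, k (w, c w) == p w.2 w.1].

(** The condition fixes one of the [D] candidates for each of the [#|A| * l] pairs and leaves the
    others free. *)
Lemma card_selects (A : finType) (l D : nat) (p : {ffun 'I_l -> {perm A}})
    (c : {ffun A * 'I_l -> 'I_D}) :
  #|A| ^ (#|A| * l) * #|[set k | selects p k c]| = #|A| ^ (#|A| * l * D).
Proof.
pose F (w : A * 'I_l * 'I_D) : pred A :=
  if w.2 == c w.1 then pred1 (p w.1.2 w.1.1) else predT.
have -> : #|[set k | selects p k c]| = #|family F|.
  apply: eq_card => k; rewrite inE; apply/forallP/familyP => /= kP.
    move=> [w j]; rewrite /F /=; case: eqP => // ->; exact: kP.
  by move=> w; have := kP (w, c w); rewrite /F /= eqxx.
rewrite card_family foldrE big_map big_enum /=.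
rewrite -(pair_bigA _ (fun w j => #|F (w, j)|)) /=.
have -> : #|A| * l = #|{: A * 'I_l}| by rewrite card_prod card_ord.
rewrite expnM -!prod_nat_const -big_split /=.
rewrite (big_morph _ (fun x y => expnMn x y _) (exp1n _)).
apply: eq_bigr => w _; rewrite (bigD1 (c w)) //= /F /= eqxx card1 mul1n.
under eq_bigr => j jc do rewrite (negPf jc).
rewrite prod_nat_const cardC1 card_ord -expnS prednK //.
by case: D c {F} => [|//] /(_ w) [].
Qed.

(* Double counting of the triples (p, k, c) such that [selects p k c]: those
   where [k] meets some [H p] at [L] points or more are rare by [heavy_bound],
   and for the other [k] the graph of [c] lies in one of few small sets. *)
Lemma triples_bound (A : finType) (l D L s C N1 N2 : nat)
    (H : {ffun 'I_l -> {perm A}} -> {set A * A}) :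
  0 < s ->
  (forall (p : {ffun 'I_l -> {perm A}}) i a, (a, p i a) \in H p) ->
  (forall p, s * #|H p| <= C * #|A| ^ 2) ->
  #|[set H p | p in setT]| <= N1 ->
  (forall k : {ffun A * 'I_l * 'I_D -> A}, #|[set hits k (H p) | p in setT]| <= N2) ->
  #|A|`! ^ l * D ^ (#|A| * l) * s ^ L <=
  #|A| ^ (#|A| * l) *
    (N1 * C.+1 ^ (#|A| * l * D) * D ^ (#|A| * l) + N2 * 2 ^ L * s ^ L).
Proof.
move=> s0 pH Hs HN1 HN2; set m := #|A|.
pose T := {ffun 'I_l -> {perm A}}.
pose Kt := {ffun A * 'I_l * 'I_D -> A}; pose Ct := {ffun A * 'I_l -> 'I_D}.
have cK : #|{: Kt}| = m ^ (m * l * D) by rewrite card_ffun !card_prod !card_ord.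
have cC : #|{: Ct}| = D ^ (m * l) by rewrite card_ffun !card_prod !card_ord.
pose X := [set t : T * (Kt * Ct) | selects t.1 t.2.1 t.2.2].
pose Y k := [set c : Ct | [exists p, selects p k c]].
have XY : #|X| <= \sum_(k : Kt) #|Y k|.
  have -> : \sum_(k : Kt) #|Y k| = #|[set w : Kt * Ct | w.2 \in Y w.1]|.
    by rewrite card_set_pair; apply: eq_bigr => k _; apply: eq_card => c; rewrite !inE.
  (* [k] and [c] determine [p], so forgetting [p] merges no triples. *)
  have inj : {in X &, injective (@snd T (Kt * Ct))}.
    move=> [p [k c]] [p' [k' c']]; rewrite !inE /= => /forallP pk /forallP pk' [kk cc].
    rewrite -kk -cc in pk' *; congr (_, (_, _)); apply/ffunP => i; apply/permP => a.
    by rewrite -(eqP (pk (a, i))) -(eqP (pk' (a, i))).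
  rewrite -(card_in_imset inj); apply/subset_leq_card/subsetP => w.
  case/imsetP => -[p [k c]] pkc ->; rewrite !inE /=.
  by apply/existsP; exists p; move: pkc; rewrite inE.
have cX : m ^ (m * l) * #|X| = m`! ^ l * D ^ (m * l) * m ^ (m * l * D).
  have -> : #|X| = \sum_(p : T) \sum_(c : Ct) #|[set k | selects p k c]|.
    rewrite card_set_pair; apply: eq_bigr => q _.
    have swapI : injective (fun w : Kt * Ct => (w.2, w.1)) by move=> [? ?] [? ?] [-> ->].
    rewrite -(card_imset _ swapI) card_set_pair /=; apply: eq_bigr => c _.
    apply: eq_card => k; rewrite !inE; apply/imsetP/idP => [[w]|pkc].
      by rewrite !inE => wP [-> ->].
    by exists (k, c); rewrite // !inE.
  rewrite big_distrr /=; under eq_bigr do rewrite big_distrr /=.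
  under eq_bigr do under eq_bigr do rewrite card_selects.
  rewrite !sum_nat_const cC card_ffun card_ord mulnA.
  have -> // : #|{: {perm A}}| = m`!.
  rewrite -[RHS]/(#|A|`!) -cardsT -card_perm -cardsE; apply: eq_card => q.
  by rewrite !inE; apply/esym/subsetP.
pose bad (k : Kt) := [exists p, L <= #|hits k (H p)|].
have cbad : #|[set k | bad k]| * s ^ L <= N1 * (C.+1 * m) ^ (m * l * D).
  pose B h := [set k : Kt | L <= #|hits k h|].
  apply: (@leq_trans (#|[set H p | p in setT]| * (C.+1 * m) ^ (m * l * D))); last first.
    by rewrite leq_mul2r HN1 orbT.
  apply: (@leq_trans (\sum_(h in [set H p | p in setT]) #|B h| * s ^ L)).
    rewrite -big_distrl /= leq_mul2r; apply/orP; right.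
    apply: (@leq_trans #|\bigcup_(h in [set H p | p in setT]) B h|).
      apply/subset_leq_card/subsetP => k; rewrite inE => /existsP[p Lp].
      by apply/bigcupP; exists (H p); [apply: imset_f | rewrite inE].
    elim/big_rec2: _ => [|h n U _ le1]; first by rewrite cards0.
    by apply: leq_trans (leq_card_setU (B h) U) _; rewrite leq_add2l.
  rewrite -sum_nat_const; apply: leq_sum => h /imsetP[p _ ->].
  exact: heavy_bound.
(* If [c] selects [p] from [k], all its choices are hits of [H p]: [c] is a section of one of at
   most [N2] traces, each with fewer than [L] points. *)
have Ygood k : ~~ bad k -> #|Y k| <= N2 * 2 ^ L.
  move=> /existsPn good.
  pose S (P : {set A * 'I_l * 'I_D}) := [set c : Ct | [forall w, (w, c w) \in P]].
  apply: (@leq_trans #|\bigcup_(P in [set hits k (H p) | p in [set: T]]) S P|).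
    apply/subset_leq_card/subsetP => c; rewrite inE => /existsP[p /forallP pkc].
    apply/bigcupP; exists (hits k (H p)); first exact: imset_f.
    by rewrite inE; apply/forallP => -[a i]; rewrite inE /= (eqP (pkc (a, i))).
  apply: leq_trans (card_union_bound (n := 2 ^ L) _) _; last first.
    by rewrite leq_mul2r HN2 orbT.
  move=> P /imsetP[p _ ->]; apply: leq_trans (card_sections _) _.
  by rewrite leq_exp2l //; have := good p; rewrite -ltnNge => /ltnW.
have YN : \sum_(k : Kt) #|Y k| <=
    #|[set k | bad k]| * D ^ (m * l) + m ^ (m * l * D) * (N2 * 2 ^ L).
  rewrite (bigID bad) /=; apply: leq_add.
    rewrite -sum_nat_const big_mkcond [leqRHS]big_mkcond; apply: leq_sum => k _.
    by rewrite inE; case: ifP => // _; rewrite -cC max_card.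
  rewrite -cK -sum_nat_const big_mkcond; apply: leq_sum => k _.
  by case: ifP => // /Ygood.
(* This holds for [m = 0] too, since the exponent is then 0 as well. *)
have M0 : 0 < m ^ (m * l * D) by case: (m) => [|n]; rewrite ?expn_gt0.
rewrite -(leq_pmul2r M0).
rewrite mulnAC -cX -mulnA -mulnA leq_mul2l; apply/orP; right.
apply: (@leq_trans ((#|[set k | bad k]| * D ^ (m * l) +
    m ^ (m * l * D) * (N2 * 2 ^ L)) * s ^ L)).
  by rewrite leq_mul2r (leq_trans XY YN) orbT.
rewrite mulnDl [leqRHS]mulnDl leq_add //; last by rewrite -!mulnA mulnC -!mulnA.
rewrite mulnAC; apply: (leq_trans (leq_mul cbad (leqnn _))).
rewrite expnMn; apply: eq_leq; ring.
Qed.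

(** * Choice of the parameters *)

Lemma ffact_le_exp (n k : nat) : n ^_ k <= n ^ k.
Proof.
elim: k n => [|k IH] n; first by rewrite ffactn0.
rewrite ffactnS expnS leq_mul2l (leq_trans (IH _)) ?orbT //.
by case: k {IH} => // k; rewrite leq_exp2r // leq_pred.
Qed.

Lemma exp_le_ffact (n k : nat) : n ^ k <= (n + k) ^_ k.
Proof.
elim: k n => [|k IH] n //; rewrite addnS ffactnS expnS leq_mul //.
  by rewrite ltnW // ltnS leq_addr.
Qed.

(** The falling factorial [(k + k) ^_ k] lies between: it is the factorial of [k] times a central
    binomial coefficient. *)
Lemma expnn_le_fact (k : nat) : k ^ k <= 4 ^ k * k`!.
Proof.
apply: leq_trans (exp_le_ffact k k) _; rewrite -bin_ffact leq_mul2r.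
apply/orP; right; rewrite -[4]/(2 ^ 2) -expnM mul2n -addnn -[2]/(1 + 1) Pascal.
rewrite (bigD1 (inord k : 'I_(k + k).+1)) //= inordK ?ltnS ?leq_addr //.
by rewrite !exp1n !muln1 leq_addr.
Qed.

Lemma bin_le_exp (n k : nat) : 'C(n, k) <= n ^ k.
Proof.
apply: leq_trans (ffact_le_exp n k); rewrite -bin_ffact leq_pmulr //.
exact: fact_gt0.
Qed.

(** For [n] proportional to [k] this is exponential in [k], unlike [bin_le_exp]; it serves for the
    traces on the sparse graph. *)
Lemma bin_expnn_le (n k : nat) : 'C(n, k) * k ^ k <= (4 * n) ^ k.
Proof.
apply: (@leq_trans ('C(n, k) * (4 ^ k * k`!))).
  by rewrite leq_mul2l expnn_le_fact orbT.
by rewrite mulnCA bin_ffact expnMn leq_mul2l ffact_le_exp orbT.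
Qed.

(* [m] is a square so that the bound [m ^ (3/2)] on the number of edges of the
   graphs at few distances is an integer, [s ^ 3].  In the exponent [31 * m],
   the number of these graphs, at most [s ^ (30 * m)], absorbs [30 * m], and
   the rest absorbs the factors [O(1) ^ m]. *)
Lemma counting_gap (d : nat) : exists D s, [/\ 0 < s &
  let m := s ^ 2 in let v := 4 * m + d in let L := 31 * m in
  m ^ (m * 5) *
    ('C(v + 2 * (m * m * d), v) * (2 * d + 2) ^ (m * 5 * D) * D ^ (m * 5) +
     'C(v + 2 * (m * 5 * D * d), v) * 2 ^ L * s ^ L)
  < m`! ^ 5 * D ^ (m * 5) * s ^ L].
Proof.
(* [Q ^ m] will absorb [4 * 4 ^ (m * 5) * 2 ^ L]; being opaque, [Q] is never computed. *)
have [Q Qdef] : exists Q, Q = 4 ^ 6 * 2 ^ 31 by eexists.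
have Q0 : 0 < Q by rewrite Qdef muln_gt0 !expn_gt0.
(* There are at most [(K * D) ^ v] traces, and [2 * v <= 9 * m] against [D ^ (m * 5)]. After
   squaring, a factor [D ^ m] is left to absorb [Q ^ (2 * m) * K ^ (9 * m)]. *)
pose K := 10 * d + 4; pose D := Q ^ 2 * K ^ 9.
have K0 : 0 < K by rewrite /K addn_gt0 orbT.
have D0 : 0 < D by rewrite muln_gt0 !expn_gt0 Q0 K0.
have DQ : Q ^ 2 * K ^ 9 <= D by [].
move: D D0 DQ => D D0 DQ.
(* [s ^ m] has to absorb [4 * 4 ^ (m * 5)] and [(2 * d + 2) ^ (m * 5 * D)]. *)
pose s := 4 ^ 6 * (2 * d + 2) ^ (5 * D).
have s_ge : 4 ^ 6 * (2 * d + 2) ^ (5 * D) <= s by [].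
have sd : 2 * d + 5 <= s.
  have le1 : (2 * d + 2) ^ 1 <= (2 * d + 2) ^ (5 * D).
    by rewrite leq_pexp2l ?muln_gt0 // addn_gt0 orbT.
  by rewrite expn1 in le1; rewrite /s; set w := _ ^ (5 * D) in le1 *; lia.
move: s s_ge sd => s s_ge sd.
have s0 : 0 < s by lia.
exists D, s; split => // m v L.
have m_ge : 2 * d + 5 <= m by rewrite /m; nia.
have m0 : 0 < m by lia.
have v9 : 2 * v <= 9 * m by rewrite /v; lia.
have v5 : v <= 5 * m by lia.
(* [p1] and [p2] make each summand at most a quarter of the right-hand side; [4 ^ (m * 5)] is the
   cost of replacing [m ^ m] by a factorial. *)
have p1 : 4 * (4 ^ (m * 5) *
    ('C(v + 2 * (m * m * d), v) * (2 * d + 2) ^ (m * 5 * D))) <= s ^ L.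
  have N1 : 'C(v + 2 * (m * m * d), v) <= s ^ (30 * m).
    apply: leq_trans (bin_le_exp _ _) _.
    apply: (@leq_trans ((m ^ 3) ^ (5 * m))).
      apply: (@leq_trans ((m ^ 3) ^ v)); last by rewrite leq_pexp2l // expn_gt0 m0.
      have le3 : v + 2 * (m * m * d) <= m ^ 3 by nia.
      by have [->|v0] := posnP v; rewrite // leq_exp2r.
    by rewrite /m -!expnM leq_pexp2l //; lia.
  have -> : s ^ L = s ^ (30 * m) * s ^ m by rewrite -expnD /L; congr (_ ^ _); lia.
  have le1 : 4 * 4 ^ (m * 5) * (2 * d + 2) ^ (m * 5 * D) <= s ^ m.
    apply: (@leq_trans ((4 ^ 6 * (2 * d + 2) ^ (5 * D)) ^ m)); last by rewrite leq_exp2r.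
    rewrite -expnS expnMn -!expnM leq_mul // leq_pexp2l ?addn_gt0 ?orbT //; first by lia.
    nia.
  apply: leq_trans (leq_mul N1 le1); apply: eq_leq; ring.
have p2 : 4 * (4 ^ (m * 5) * ('C(v + 2 * (m * 5 * D * d), v) * 2 ^ L)) <= D ^ (m * 5).
  set N2 := 'C(_, _).
  have N2le : N2 <= (K * D) ^ v.
    have [v0|v0] := posnP v; first by rewrite /N2 v0 bin0 expn0.
    have vv : 0 < v ^ v by rewrite expn_gt0 v0.
    rewrite -(leq_pmul2r vv); apply: leq_trans (bin_expnn_le _ _) _.
    by rewrite -expnMn leq_exp2r // /K; nia.
  have N2sq : N2 ^ 2 <= (K * D) ^ (9 * m).
    apply: (@leq_trans (((K * D) ^ v) ^ 2)); first by rewrite leq_exp2r.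
    by rewrite -expnM leq_pexp2l ?muln_gt0 ?K0 // mulnC.
  have Qm : 4 * 4 ^ (m * 5) * 2 ^ L <= Q ^ m.
    rewrite Qdef expnMn -!expnM -expnS leq_mul // leq_pexp2l //; lia.
  rewrite -(@leq_exp2r _ _ 2) //.
  have -> : 4 * (4 ^ (m * 5) * (N2 * 2 ^ L)) = 4 * 4 ^ (m * 5) * 2 ^ L * N2 by ring.
  rewrite expnMn; apply: (@leq_trans ((Q ^ m) ^ 2 * (K * D) ^ (9 * m))).
    by rewrite leq_mul // leq_exp2r.
  have -> : (D ^ (m * 5)) ^ 2 = D ^ m * D ^ (9 * m).
    by rewrite -expnM -expnD; congr (_ ^ _); lia.
  rewrite expnMn mulnA leq_mul //.
  have -> : (Q ^ m) ^ 2 * K ^ (9 * m) = (Q ^ 2 * K ^ 9) ^ m.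
    by rewrite expnMn -!expnM (mulnC m).
  by rewrite leq_exp2r.
have fm : m ^ (m * 5) <= 4 ^ (m * 5) * m`! ^ 5.
  by rewrite (expnM m) (expnM 4) -expnMn leq_exp2r // expnn_le_fact.
set N1 := 'C(_, _) in p1 *; set N2 := 'C(_, _) in p2 *.
set X := N1 * _ in p1 *; set sL := s ^ L in p1 *; set DD := D ^ _ in p2 *.
set F := 4 ^ (m * 5) in p1 p2 fm.
have pos : 0 < m`! ^ 5 * DD * sL by rewrite !muln_gt0 !expn_gt0 fact_gt0 D0 s0.
apply: (leq_ltn_trans (leq_mul fm (leqnn _))).
rewrite -(ltn_pmul2l (isT : 0 < 4)).
apply: (@leq_ltn_trans (2 * (m`! ^ 5 * DD * sL))); last by rewrite ltn_pmul2r.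
rewrite mul2n -addnn.
have -> : 4 * (F * m`! ^ 5 * (X * DD + N2 * 2 ^ L * sL)) =
    m`! ^ 5 * (4 * (F * X)) * DD + m`! ^ 5 * (4 * (F * (N2 * 2 ^ L))) * sL by ring.
apply: leq_add.
  by rewrite mulnAC leq_mul2l p1 orbT.
by rewrite leq_mul2r leq_mul2l p2 !orbT.
Qed.

(** * The graphs *)

(* The 6-clique makes the maximum degree exactly 5 even when the permutations
   agree at every point. *)
Definition layered_adj (A : finType) (p : {ffun 'I_5 -> {perm A}}) : rel (A + A + 'I_6) :=
  fun x y => match x, y with
  | inl (inl a), inl (inr b) => [exists i, p i a == b]
  | inl (inr b), inl (inl a) => [exists i, p i a == b]
  | inr i, inr j => i != j
  | _, _ => false
  end.

Lemma layered_adj_sym (A : finType) (p : {ffun 'I_5 -> {perm A}}) :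
  symmetric (layered_adj p).
Proof. by move=> [[a|a]|i] [[b|b]|j] //=; rewrite eq_sym. Qed.

Lemma layered_adj_irr (A : finType) (p : {ffun 'I_5 -> {perm A}}) :
  irreflexive (layered_adj p).
Proof. by move=> [[a|a]|i] //=; rewrite eqxx. Qed.

Definition layered (A : finType) (p : {ffun 'I_5 -> {perm A}}) : sgraph :=
  SGraph (layered_adj_sym p) (layered_adj_irr p).

Lemma max_degree_layered (A : finType) (p : {ffun 'I_5 -> {perm A}}) :
  max_degree (layered p) = 5.
Proof.
have image5 (v : layered p) (h : 'I_5 -> layered p) :
    (forall w, adj v w -> exists i, w = h i) -> (degree v <= 5)%N.
  move=> vh; rewrite -[leqRHS](card_ord 5).
  apply: leq_trans (leq_imset_card h _).
  apply/subset_leq_card/subsetP => w; rewrite inE => /vh[i ->].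
  exact: imset_f.
have cliqueE (i : 'I_6) : degree (inr i : layered p) = 5.
  transitivity #|predC1 i|; last by rewrite cardC1 card_ord.
  rewrite -(card_imset (predC1 i) (@inr_inj (A + A) 'I_6)).
  apply: eq_card => w; rewrite inE; apply/idP/imsetP.
    by case: w => [[a|a]|j] //= ij; exists j; rewrite // inE eq_sym.
  by move=> [j]; rewrite inE => ij ->; rewrite /= eq_sym.
apply/eqP; rewrite eqn_leq; apply/andP; split; last first.
  by rewrite -(cliqueE ord0); exact: leq_bigmax.
apply/bigmax_leqP => -[[a|b]|i] _; last by rewrite cliqueE.
  apply: (image5 _ (fun i => inl (inr (p i a)))) => -[[c|c]|j] //= /existsP[i /eqP <-].
  by exists i.
apply: (image5 _ (fun i => inl (inl ((p i)^-1%g b)))).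
move=> -[[c|c]|j] //= /existsP[i /eqP <-].
by exists i; rewrite permK.
Qed.

Lemma degenerate_distance_number_le (R : realType) (G : sgraph) (d : nat) :
  (degenerate_distance_number R G <= d)%N ->
  exists (f : G -> R * R) (z : 'I_d -> R), injective f /\
    forall v w, adj v w -> exists k, sqdist (f v) (f w) = z k.
Proof.
rewrite /degenerate_distance_number.
case: ex_minnP => n /asboolP[D <-] _ le.
(* The list of lengths has at most [d] entries and is padded with zeros. *)
exists D, (fun k => (undup (edge_lengths D))`_k%R ^+ 2)%R; split.
  exact: position_inj.
move=> v w vw.
have mem : edist (D v) (D w) \in undup (edge_lengths D).
  rewrite mem_undup; apply: (@image_f _ _ (fun e => edist (D e.1) (D e.2)) _ (v, w)).
  by rewrite inE.
have lt : (index (edist (D v) (D w)) (undup (edge_lengths D)) < d)%N.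
  by apply: leq_trans le; rewrite index_mem.
exists (Ordinal lt) => /=; rewrite nth_index // sqr_sqrtr //.
by rewrite addr_ge0 ?sqr_ge0.
Qed.

Theorem theorem18 (R : realType) (d : nat) :
  exists G : sgraph,
    max_degree G = 5 /\ (d < degenerate_distance_number R G)%N.
Proof.
have [D [s [s0]]] := counting_gap d.
set m := (s ^ 2)%N; set v := (4 * m + d)%N => /= gap.
pose A : finType := 'I_m.
apply: contrapT => noG.
have drawn (p : {ffun 'I_5 -> {perm A}}) :
    exists fz : (layered p -> R * R) * ('I_d -> R), injective fz.1 /\
    forall v w : layered p, adj v w -> exists k, sqdist (fz.1 v) (fz.1 w) = fz.2 k.
  have /degenerate_distance_number_le[f [z [finj fz]]] :
      (degenerate_distance_number R (layered p) <= d)%N.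
    rewrite leqNgt; apply/negP => lt; apply: noG.
    by exists (layered p); split=> //; exact: max_degree_layered.
  by exists (f, z).
(* One drawing is chosen for each [p], which makes [H] a function of [p]. *)
pose f p := (sval (cid (drawn p))).1; pose z p := (sval (cid (drawn p))).2.
have finj p : injective (f p) := (svalP (cid (drawn p))).1.
have fz p := (svalP (cid (drawn p))).2.
pose pA p a := f p (inl (inl a)); pose pB p b := f p (inl (inr b)).
pose H p := at_distance (pA p) (pB p) (z p).
have pH (p : {ffun 'I_5 -> {perm A}}) i a : (a, p i a) \in H p.
  rewrite inE; have [|k kE] := fz p (inl (inl a)) (inl (inr (p i a))).
    by apply/existsP; exists i.
  by apply/existsP; exists k; apply/eqP.
(* Since [s * s ^ 3 = m ^ 2], the density constant is [2 * d + 1], whence the base [2 * d + 2] in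
   [counting_gap]. *)
have Hs p : (s * #|H p| <= (2 * d + 1) * #|A| ^ 2)%N.
  have pAinj : injective (pA p) by move=> a a' /finj[].
  have pBinj : injective (pB p) by move=> a a' /finj[].
  have := few_distances_bound (z p) pAinj pBinj (card_ord m) (card_ord m).
  rewrite !card_ord => le.
  apply: (@leq_trans (s * ((2 * d + 1) * s ^ 3))%N); first by rewrite leq_mul2l le orbT.
  by rewrite mulnCA -expnS /m -expnM.
have patterns (E : finType) (phi : E -> A * A) :
    (#|[set [set e | phi e \in H p] | p in setT]| <= 'C(v + 2 * (#|E| * d), v))%N.
  have := card_distance_patterns phi pA pB z.
  by rewrite !card_ord (_ : 2 * (m + m) + d = v)%N // /v; lia.
have N1 : (#|[set H p | p in setT]| <= 'C(v + 2 * (m * m * d), v))%N.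
  have -> : [set H p | p in setT] = [set [set w | id w \in H p] | p in setT].
    by apply: eq_imset => p; apply/setP => w; rewrite inE.
  by have := patterns _ id; rewrite card_prod card_ord.
have N2 (k : {ffun A * 'I_5 * 'I_D -> A}) :
    (#|[set hits k (H p) | p in setT]| <= 'C(v + 2 * (m * 5 * D * d), v))%N.
  by have := patterns _ (fun w => (w.1.1, k w)); rewrite !card_prod !card_ord.
have := triples_bound (31 * m) s0 pH Hs N1 N2.
by rewrite card_ord -addnS leqNgt gap.
Qed.
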